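(* Let $G$ be a (finite, loopless) multigraph and let $f$ be a demand function for the line graph $L(G)$ such that each edge $e\in V(L(G))$ with endpoints $u,v$ satisfies $f(e) \leq 1/(\max\{d(u), d(v)\} + \mu(uv))$, where $\mu(uv)$ is the number of edges of $G$ incident to both $u$ and $v$. Then $L(G)$ has an $f$-coloring.
   Context: For a multigraph $G$, $d(v)=\sum_{u\in N(v)}\mu(uv)$ is the number of edges incident to $v$. The line graph $L(G)$ has vertex set $E(G)$, two edges being adjacent when they share an endpoint. A demand function for a graph $H$ is a function $f: V(H)\to [0,1]\cap\mathbb{Q}$. A fractional coloring of $H$ is a function $\phi$ assigning to each vertex a measurable subset of $[0,1]$ such that adjacent vertices receive disjoint sets. An $f$-coloring is a fractional coloring $\phi$ with Lebesgue measure of $\phi(x)$ at least $f(x)$ for every vertex $x$. *)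

(* Defs.v *)
From HB Require Import structures.
From mathcomp Require Import all_boot all_order all_algebra.
From mathcomp Require Import all_classical all_reals all_analysis.
Set Implicit Arguments. Unset Strict Implicit. Unset Printing Implicit Defensive.
Import Order.TTheory GRing.Theory Num.Theory.
Local Open Scope classical_set_scope.

(* A finite multigraph: vertex type V, edge type E, each edge e has the
   (ordered, but only used as unordered) pair of endpoints [ends e]. *)

Definition loopless (V E : finType) (ends : E -> V * V) : Prop :=
  forall e : E, (ends e).1 != (ends e).2.

Definition incident (V E : finType) (ends : E -> V * V) (v : V) (e : E) : bool :=
  (v == (ends e).1) || (v == (ends e).2).

Definition deg (V E : finType) (ends : E -> V * V) (v : V) : nat :=
  #|[set e : E | incident ends v e]|.

Definition mult (V E : finType) (ends : E -> V * V) (u v : V) : nat :=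
  #|[set e : E | incident ends u e && incident ends v e]|.

Definition line_adj (V E : finType) (ends : E -> V * V) (e e' : E) : bool :=
  (e != e') && (incident ends (ends e).1 e' || incident ends (ends e).2 e').

Definition demand (E : finType) (f : E -> rat) : Prop :=
  forall e, (0 <= f e <= 1)%R.

Definition f_coloring (R : realType) (V E : finType) (ends : E -> V * V)
    (f : E -> rat) (phi : E -> set R) : Prop :=
  (forall e, phi e `<=` `[0%R, 1%R]%classic /\ measurable (phi e)) /\
  (forall e e', line_adj ends e e' -> phi e `&` phi e' = set0) /\
  (forall e, ((ratr (f e) : R)%:E <= (@lebesgue_measure R) (phi e))%E).

(* Main.v *)
Require Import Defs.
From HB Require Import structures.
From mathcomp Require Import all_boot all_order all_algebra.
From mathcomp Require Import all_classical all_reals all_analysis.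
From mathcomp Require Import ring lra zify.
Import Order.TTheory GRing.Theory Num.Theory.
Set Implicit Arguments.
Unset Strict Implicit.
Unset Printing Implicit Defensive.

(* By Farkas' lemma, [f] is a convex combination of matchings (and then an
   f-coloring is read off by cutting [0, 1] into intervals of the given
   lengths) as soon as every integer weight [w] admits a matching [M] with
   [sum w f <= w(M)]. This holds under Edmonds' conditions: [f] sums to at most
   1 on each star and to at most [|U| / 2] (rounded down) inside each vertex
   set [U]. By induction on the total weight, one either lowers [w] on the star
   of a vertex covered by all maximum-weight matchings, or, if there is no such
   vertex, inside a component [C] of the support of [w]; there a Gallai-type
   exchange argument yields an optimal matching missing at most one vertex of
   [C].
   The local bound on [f] implies Edmonds' conditions: for [|U| = k + 1] and
   [v] in [U], the edges at [v] inside [U] contribute at most the sum of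
   [mu / (d(v) + mu)] over at most [k] neighbours, whose multiplicities add up
   to at most [d(v)], and by concavity this is at most [k / (k + 1)]. *)

(** * Linear duality over an ordered field *)

Section Farkas.
Local Open Scope ring_scope.
Variable (F : realFieldType).

Definition dot (T : finType) (a x : T -> F) : F := \sum_i a i * x i.

Lemma dotBl (T : finType) (a b x : T -> F) c :
  dot (fun i => a i - c * b i) x = dot a x - c * dot b x.
Proof.
rewrite /dot mulr_sumr -sumrB; apply: eq_bigr => i _.
by rewrite mulrBl mulrA.
Qed.

Lemma dotBr (T : finType) (a x y : T -> F) c :
  dot a (fun i => x i - c * y i) = dot a x - c * dot a y.
Proof.
rewrite /dot mulr_sumr -sumrB; apply: eq_bigr => i _; ring.
Qed.

(* Bartl's algebraic proof: eliminate one functional by projecting along a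
   point where it alone is violated. *)
Lemma farkas (T : finType) (J : eqType) (s : seq J) (a : J -> T -> F) (b : T -> F) :
  uniq s ->
  (forall x, (forall j, j \in s -> dot (a j) x <= 0) -> dot b x <= 0) ->
  exists2 c : J -> F, (forall j, 0 <= c j) & forall i, b i = \sum_(j <- s) c j * a j i.
Proof.
elim: s a b => [|j0 s IH] a b.
  move=> _ b_le0; exists (fun=> 0) => // i; rewrite big_nil.
  have dotD y : dot b (fun k => y * (k == i)%:R) = y * b i.
    rewrite /dot (bigD1 i) //= eqxx mulr1 mulrC big1 ?addr0 // => k /negPf ->.
    by rewrite !mulr0.
  apply/le_anti/andP; split.
    have := b_le0 (fun k => 1 * (k == i)%:R) (fun _ => ltac:(by [])).
    by rewrite dotD mul1r.
  have := b_le0 (fun k => -1 * (k == i)%:R) (fun _ => ltac:(by [])).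
  by rewrite dotD mulN1r oppr_le0.
rewrite cons_uniq => /andP[j0s us] b_le0.
have drop (c0 : F) (c : J -> F) i :
    \sum_(j <- j0 :: s) (if j == j0 then c0 else c j) * a j i
    = c0 * a j0 i + \sum_(j <- s) c j * a j i.
  rewrite big_cons eqxx; congr (_ + _); apply: eq_big_seq => j js.
  by case: eqP => // jj; rewrite jj (negPf j0s) in js.
have [sImp|] := pselect (forall x,
    (forall j, j \in s -> dot (a j) x <= 0) -> dot b x <= 0).
  have [c c0 cE] := IH a b us sImp.
  exists (fun j => if j == j0 then 0 else c j) => [j|i]; first by case: ifP.
  by rewrite drop mul0r add0r.
move=> /existsNP[y0 /not_implyP[y0_le /negP]]; rewrite -ltNge => by0.
have ay0 : 0 < dot (a j0) y0.
  rewrite ltNge; apply/negP => ay_le; have := b_le0 y0; rewrite leNgt by0 => H.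
  suff: false by []; apply: H => j; rewrite inE => /orP[/eqP ->//|]; exact: y0_le.
(* Subtracting [t j] times [a j0] from [a j] makes it vanish at [y0], and [tb] does the same for
   [b]. The test point [x] is then moved along [y0] into the kernel of [a j0]. *)
pose r := (dot (a j0) y0)^-1.
have r_gt0 : 0 < r by rewrite invr_gt0.
pose t j := dot (a j) y0 * r.
have t_le0 j : j \in s -> t j <= 0.
  by move=> js; rewrite mulr_le0_ge0 ?y0_le // ltW.
pose tb := dot b y0 * r.
have [|c c0 cE] := IH (fun j i => a j i - t j * a j0 i) (fun i => b i - tb * a j0 i) us.
  move=> x x_le; rewrite dotBl.
  have := b_le0 (fun i => x i - (dot (a j0) x * r) * y0 i).
  rewrite dotBr (_ : _ - _ * dot b y0 = dot b x - tb * dot (a j0) x); last first.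
    by rewrite /tb; ring.
  apply.
  move=> j; rewrite inE => /orP[/eqP ->|js].
    by rewrite dotBr -mulrA mulVf ?gt_eqF // mulr1 subrr.
  have := x_le j js; rewrite dotBl dotBr /t; congr (_ <= _); ring.
(* The new coefficient is nonnegative because [tb] is positive and every [t j] is nonpositive. *)
exists (fun j => if j == j0 then tb - \sum_(j <- s) c j * t j else c j).
  move=> j; case: ifP => // _; rewrite subr_ge0.
  apply: (@le_trans _ _ 0); last by rewrite mulr_ge0 // ltW.
  rewrite big_seq; apply: sumr_le0 => k ks; exact: mulr_ge0_le0 (c0 k) (t_le0 k ks).
move=> i; rewrite drop; have /eqP := cE i; rewrite subr_eq => /eqP ->.
rewrite mulrBl mulr_suml addrC -addrA; congr (_ + _).
rewrite -sumrN -big_split /=; apply: eq_bigr => j _; ring.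
Qed.

(** Lets a bound proved for integer weights be applied to rational test vectors. *)
Lemma rat_common_denominator (T : finType) (x : T -> rat) :
  exists2 D : nat, (0 < D)%N & forall i, exists z : int, D%:R * x i = z%:~R.
Proof.
pose D : int := \prod_i denq (x i).
have D_gt0 : 0 < D by apply: prodr_gt0 => i _.
exists `|D|%N; first by rewrite absz_gt0 gt_eqF.
move=> i; exists (\prod_(j | j != i) denq (x j) * numq (x i)).
rewrite natr_absz gtr0_norm // /D (bigD1 i) //= !rmorphM /= numqE; ring.
Qed.

End Farkas.

(* [X] is the orbit of [t] under [n \o m]: a fixed point of [m] at position [i]
   forces this orbit to have length [2 i + 1], so there is at most one. *)
Lemma alternating_orbit (V : finType) (m n : V -> V) (t : V) :
  involutive m -> involutive n -> n t = t ->
  exists X : {set V},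
    [/\ t \in X, forall x, x \in X -> m x \in X, forall x, x \in X -> n x \in X,
        forall u v, u \in X -> v \in X -> m u = u -> m v = v -> u = v
      & forall C : {set V}, t \in C -> (forall x, x \in C -> m x \in C) ->
          (forall x, x \in C -> n x \in C) -> X \subset C].
Proof.
move=> mK nK nt; pose s x := n (m x).
have s_inj : injective s by move=> x y sxy; apply: (can_inj mK); apply: (can_inj nK).
(* Both involutions conjugate [s] to its inverse, so they act on the orbit as reflections; [ns] also
   uses [n t = t]. *)
have ns k : iter k s (n (iter k s t)) = t.
  have H y : iter k s (n (iter k s y)) = n y.
    elim: k y => // k IH y.
    by rewrite iterS iterSr IH /s nK mK.
  by rewrite H.
have ms k : iter k s (m (iter k s t)) = m t.
  have H y : iter k s (m (iter k s y)) = m y.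
    elim: k y => // k IH y.
    by rewrite iterS iterSr IH /s mK nK.
  by rewrite H.
pose X := [set x | fconnect s t x].
have sC := fconnect_sym s_inj.
have Xn x : x \in X -> n x \in X.
  rewrite !inE => /iter_findex => <-; rewrite sC.
  set k := findex _ _ _.
  by rewrite -[in X in fconnect _ _ X](ns k) fconnect_iter.
have Xm x : x \in X -> m x \in X.
  move=> /Xn; rewrite !inE => h; rewrite (connect_trans h) // sC.
  by rewrite -[in X in fconnect _ _ X](mK x) fconnect1.
have odd_order u : u \in X -> m u = u -> (findex s t u).*2.+1 = order s t.
  rewrite inE => tu mu; have lt_i := findex_max tu.
  have ui := iter_findex tu; move: lt_i ui; set i := findex s t u => lt_i ui.
  (* Reflection by [m] gives [s^(2i) t = m t], and one more step reaches [n t = t]. As [i] is below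
     the order, [2i + 1] is below twice the order, so this return is the first one. *)
  have e1 : iter i.*2.+1 s t = t.
    by rewrite iterS -addnn iterD ui -mu -ui ms /s mK nt.
  have small j : j < order s t -> iter j s t = t -> j = 0.
    by move=> lj ej; rewrite -(findex_iter lj) ej findex0.
  have [lt|ge] := ltnP i.*2.+1 (order s t).
    by move: (small _ lt e1).
  have e2 : iter (i.*2.+1 - order s t) s t = t.
    by rewrite -[in RHS]e1 -[in RHS](subnK ge) iterD iter_order.
  have := small _ _ e2; lia.
exists X; split=> //.
- by rewrite inE connect0.
- move=> u v Xu Xv mu mv.
  have := odd_order _ Xu mu; rewrite -(odd_order _ Xv mv) => /eqP.
  rewrite eqSS => /eqP /double_inj eqf.
  move: Xu Xv; rewrite !inE => /iter_findex <- /iter_findex <-.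
  by rewrite eqf.
- move=> C Ct Cm Cn; apply/fintype.subsetP => x; rewrite inE => /iter_findex <-.
  by elim: (findex _ _ _) => //= k IH; apply/Cn/Cm.
Qed.

(** * Matchings and the involutions they induce *)

Section Matchings.
Variables (V E : finType) (ends : E -> V * V).
Hypothesis ends_loopless : loopless ends.
Implicit Types (M N A : {set E}) (u v x : V) (e : E).

Local Notation inc := (incident ends).

Definition matching M : bool :=
  [forall e in M, forall e' in M, ~~ line_adj ends e e'].

Definition covers M v : bool := [exists e in M, inc v e].

Definition other_end v e : V := if v == (ends e).1 then (ends e).2 else (ends e).1.

(** The identity on uncovered vertices turns a matching into an involution whose fixed points are
    the vertices it misses. *)
Definition partner M v : V :=
  if [pick e in M | inc v e] is Some e then other_end v e else v.

Definition weight (w : E -> nat) M : nat := \sum_(e in M) w e.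

Lemma incident1 e : inc (ends e).1 e. Proof. by rewrite /incident eqxx. Qed.
Lemma incident2 e : inc (ends e).2 e. Proof. by rewrite /incident eqxx orbT. Qed.

Lemma matchingP M :
  reflect (forall e e' v, e \in M -> e' \in M -> inc v e -> inc v e' -> e = e')
          (matching M).
Proof.
apply: (iffP idP) => [mM e e' v eM e'M ve ve'|H].
  move/forall_inP: mM => /(_ e eM)/forall_inP/(_ e' e'M).
  rewrite /line_adj negb_and negbK => /orP[/eqP//|].
  by rewrite negb_or; case/orP: ve => /eqP <-; rewrite ve' ?andbF.
apply/forall_inP => e eM; apply/forall_inP => e' e'M.
rewrite /line_adj negb_and negbK; apply/orP.
have [?|?] := boolP (inc (ends e).1 e').
  by left; apply/eqP; apply: (H _ _ (ends e).1); rewrite ?incident1.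
have [?|?] := boolP (inc (ends e).2 e').
  by left; apply/eqP; apply: (H _ _ (ends e).2); rewrite ?incident2.
by right.
Qed.

Lemma matching_sub M N : N \subset M -> matching M -> matching N.
Proof.
move=> /fintype.subsetP NM /matchingP mM; apply/matchingP => e e' v /NM eM /NM e'M.
exact: mM.
Qed.

Lemma matching0 : matching finset.set0.
Proof. by apply/matchingP => e e' v; rewrite inE. Qed.

Lemma incident_other v e : inc v e -> inc (other_end v e) e.
Proof. by rewrite /other_end => _; case: ifP; rewrite ?incident1 ?incident2. Qed.

Lemma other_end_neq v e : inc v e -> other_end v e != v.
Proof.
rewrite /other_end; case: (v =P (ends e).1) => [-> _|/eqP nv _].
  by rewrite eq_sym ends_loopless.
by rewrite eq_sym.
Qed.

Lemma other_endK v e : inc v e -> other_end (other_end v e) e = v.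
Proof.
rewrite /other_end /incident; case: (v =P (ends e).1) => [->|/eqP nv] /=.
  by rewrite eq_sym (negPf (ends_loopless e)).
by move/eqP ->; rewrite eqxx.
Qed.

Lemma incident_cases u v e : inc v e -> inc u e -> u = v \/ u = other_end v e.
Proof.
rewrite /other_end /incident; case: (v =P (ends e).1) => [->|/eqP nv] /=.
  by move=> _ /orP[]/eqP; [left|right].
by move=> /eqP -> /orP[]/eqP; [right|left].
Qed.

Lemma partnerE M v e : matching M -> e \in M -> inc v e -> partner M v = other_end v e.
Proof.
move=> /matchingP mM eM ve; rewrite /partner; case: pickP => [e' /andP[e'M ve']|].
  by rewrite (mM _ _ _ eM e'M ve ve').
by move=> /(_ e); rewrite eM ve.
Qed.

Lemma partner_uncovered M v : ~~ covers M v -> partner M v = v.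
Proof.
move=> ncv; rewrite /partner; case: pickP => // e /andP[eM ve].
by case/negP: ncv; apply/exists_inP; exists e.
Qed.

Lemma partner_involutive M : matching M -> involutive (partner M).
Proof.
move=> mM v; have [/exists_inP[e eM ve]|nc] := boolP (covers M v); last first.
  by rewrite !(partner_uncovered nc).
by rewrite (partnerE mM eM ve) (partnerE mM eM (incident_other ve)) other_endK.
Qed.

(** * Vertex sets that no matching edge leaves, and exchanges along them *)

Definition saturated (X : {set V}) M :=
  forall e v v', e \in M -> inc v e -> inc v' e -> v \in X -> v' \in X.

Lemma saturated_partner (X : {set V}) M :
  matching M -> (forall x, x \in X -> partner M x \in X) -> saturated X M.
Proof.
move=> mM XM e v v' eM ve v'e vX.
by case: (incident_cases ve v'e) => -> //; rewrite -(partnerE mM eM ve) XM.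
Qed.

(** When [X] is saturated, testing one endpoint selects exactly the edges of [M] inside [X]. *)
Definition edges_at (X : {set V}) M : {set E} := [set e in M | (ends e).1 \in X].

(** Double counting of incidences: each such edge has two endpoints in [X], and each covered vertex
    lies on a single edge. *)
Lemma double_card_edges_at (X : {set V}) M : matching M -> saturated X M ->
  (#|edges_at X M|).*2 = #|[set v in X | covers M v]|.
Proof.
move=> mM XM.
have -> : (#|edges_at X M|).*2
    = (\sum_(e in edges_at X M) \sum_(v in X | inc v e) 1)%N.
  rewrite -muln2 -sum_nat_const; apply: eq_bigr => e; rewrite inE => /andP[eM eX].
  rewrite sum1dep_card (_ : [set _ | _] = [set (ends e).1; (ends e).2]).
    by rewrite cards2 ends_loopless.
  apply/setP => v; rewrite !inE -/(inc v e).
  apply/andP/idP => [[] //|ve]; split=> //.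
  exact: XM eM (incident1 e) ve eX.
rewrite (exchange_big_dep [in X]) /=; last by move=> ? ? _ /andP[].
rewrite -sum1dep_card big_mkcondr /=; apply: eq_bigr => v vX.
case: (boolP (covers M v)) => [/exists_inP[e eM ve]|/negP nc].
  have eX : (ends e).1 \in X by exact: XM eM ve (incident1 e) vX.
  rewrite (big_pred1 e) // => e' /=; rewrite !inE.
  apply/idP/eqP => [/andP[/andP[e'M _]] /andP[_ ve']|->].
    by move/matchingP: mM => mM; apply: mM ve' ve.
  by rewrite eM eX vX ve.
rewrite big1 // => e; rewrite !inE => /andP[/andP[eM _] /andP[_ ve]].
by case: nc; apply/exists_inP; exists e.
Qed.

(** Edges of weight zero are discarded from an optimal matching, so that it stays within the
    components of the support. *)
Lemma max_weight_matching (g : E -> nat) : exists M,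
  [/\ matching M, forall e, e \in M -> 0 < g e
    & forall N, matching N -> weight g N <= weight g M].
Proof.
case: (@arg_maxnP _ finset.set0 matching (weight g) matching0) => M mM Mmax.
exists [set e in M | 0 < g e]; split.
- by apply: matching_sub mM; apply/fintype.subsetP => e; rewrite inE => /andP[].
- by move=> e; rewrite inE => /andP[].
- move=> N /Mmax /leq_trans; apply.
  rewrite /weight (big_setID [set e | 0 < g e]) /= -[leqRHS]addn0 leq_add //.
    by rewrite leq_eqVlt; apply/orP; left; apply/eqP/eq_bigl => e; rewrite !inE.
  rewrite big1 // => e; rewrite !inE -leqNgt leqn0 => /andP[/eqP //].
Qed.

(** Switching along an alternating path, described by the vertex set of the path. *)
Definition exchange (X : {set V}) M N : {set E} :=
  [set e | if (ends e).1 \in X then e \in N else e \in M].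

Lemma exchange_incident (X : {set V}) M N e v :
  saturated X M -> saturated X N -> e \in exchange X M N -> inc v e ->
  e \in if v \in X then N else M.
Proof.
move=> XM XN; rewrite inE; case: ifP => eX eMN ve.
  by rewrite (XN _ _ _ eMN (incident1 e) ve eX).
case: ifP => // vX; move: eX.
by rewrite (XM _ _ _ eMN ve (incident1 e) vX).
Qed.

Lemma exchange_matching (X : {set V}) M N : matching M -> matching N ->
  saturated X M -> saturated X N -> matching (exchange X M N).
Proof.
move=> /matchingP mM /matchingP mN XM XN; apply/matchingP => e e' v eA e'A ve ve'.
move: (exchange_incident XM XN eA ve) (exchange_incident XM XN e'A ve').
by case: ifP => _ h h'; [apply: mN h h' ve ve' | apply: mM h h' ve ve'].
Qed.

Lemma exchange_uncovered (X : {set V}) M N v : saturated X M -> saturated X N ->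
  ~~ covers (if v \in X then N else M) v -> ~~ covers (exchange X M N) v.
Proof.
move=> XM XN; apply: contra => /exists_inP[e eA ve].
by apply/exists_inP; exists e => //; apply: exchange_incident eA ve.
Qed.

(** The gain is stated additively because subtraction on [nat] truncates. *)
Lemma weight_exchange (X : {set V}) M N w :
  (weight w (exchange X M N) + weight w (edges_at X M)
   = weight w M + weight w (edges_at X N))%N.
Proof.
have split (A : {set E}) :
    weight w A = (weight w (edges_at X A) + \sum_(e in A | (ends e).1 \notin X) w e)%N.
  rewrite /weight (bigID (fun e => (ends e).1 \in X)) /=; congr addn.
  by apply: eq_bigl => e; rewrite inE.
have -> : edges_at X N = edges_at X (exchange X M N).
  by apply/setP => e; rewrite !inE; case: ifP; rewrite ?andbF.
rewrite (split M) (split (exchange X M N)).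
have -> : (\sum_(e in exchange X M N | (ends e).1 \notin X) w e
         = \sum_(e in M | (ends e).1 \notin X) w e)%N.
  by apply: eq_bigl => e; rewrite inE; case: ifP; rewrite ?andbF.
lia.
Qed.

(** * Maximum-weight matchings and Gallai's lemma *)

Definition max_matching (g : E -> nat) M : Prop :=
  [/\ matching M, forall e, e \in M -> 0 < g e
    & forall N, matching N -> weight g N <= weight g M].

Definition joined (w : E -> nat) : rel V :=
  fun u v => [exists e, [&& 0 < w e, inc u e & inc v e]].

Lemma card_uncovered_le1 (C : {set V}) M :
  (forall u v, u \in C -> v \in C -> ~~ covers M u -> ~~ covers M v -> u = v) ->
  #|C| <= #|[set v in C | covers M v]| + 1.
Proof.
move=> uncov; rewrite -(cardsID [set y | covers M y] C) leq_add //.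
  by rewrite subset_leq_card //; apply/fintype.subsetP => y; rewrite !inE.
apply/card_le1_eqP => y z; rewrite !inE => /andP[yc yX] /andP[zc zX].
exact: uncov.
Qed.

(** Switches [M] to [N] along the alternating path from [x]. On the support inside [C], [g] is
    [(k + 1) w - k], so a switch that loses no [w]-weight and adds no edges loses no [g]-weight. *)
Lemma alternating_exchange (w g : E -> nat) (k : nat) (C : {set V}) M N u v x :
  (forall e, (0 < g e) = (0 < w e)) ->
  (forall e y z, 0 < w e -> inc y e -> inc z e -> y \in C -> z \in C) ->
  (forall e, 0 < w e -> (ends e).1 \in C -> (g e + k = k.+1 * w e)%N) ->
  max_matching g M -> max_matching w N -> x \in C -> ~~ covers N x ->
  ~~ covers M u -> ~~ covers M v -> u != v ->
  exists M', [/\ max_matching g M', ~~ covers M' x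
               & ~~ covers M' u || ~~ covers M' v].
Proof.
move=> g_gt0 Cw gE [mM Mg maxM] [mN Nw maxN] xC Nx Mu Mv uv.
have [X [xX Xm Xn Xfix Xsub]] := alternating_orbit (partner_involutive mM)
  (partner_involutive mN) (partner_uncovered Nx).
have XM := saturated_partner mM Xm; have XN := saturated_partner mN Xn.
have Mw e : e \in M -> 0 < w e by move/Mg; rewrite g_gt0.
have pC A : matching A -> (forall e, e \in A -> 0 < w e) ->
    forall y, y \in C -> partner A y \in C.
  move=> mA Aw y yC.
  have [/exists_inP[e eA ye]|nc] := boolP (covers A y); last by rewrite partner_uncovered.
  by rewrite (partnerE mA eA ye) (Cw e y) ?incident_other ?Aw.
have XC : X \subset C by apply: Xsub => //; apply: pC.
(* [N] misses [x] in [X] while [M] misses at most one vertex of [X]. *)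
have le_card : #|edges_at X N| <= #|edges_at X M|.
  have cM := double_card_edges_at mM XM; have cN := double_card_edges_at mN XN.
  have : #|[set y in X | covers N y]| < #|X|.
    apply: proper_card; apply/properP; split.
      by apply/fintype.subsetP => y; rewrite inE => /andP[].
    by exists x => //; rewrite inE negb_and Nx orbT.
  have : #|X| <= #|[set y in X | covers M y]| + 1.
    apply: card_uncovered_le1 => y z yX zX yc zc.
    by apply: Xfix => //; apply: partner_uncovered.
  lia.
have XgE A : (forall e, e \in A -> 0 < w e) ->
    (weight g (edges_at X A) + k * #|edges_at X A| = k.+1 * weight w (edges_at X A))%N.
  move=> Aw; rewrite /weight big_distrr /= mulnC -sum_nat_const -big_split /=.
  apply: eq_bigr => e; rewrite inE => /andP[eA eX].
  by rewrite gE ?Aw // (fintype.subsetP XC).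
have gM := XgE _ Mw; have gN := XgE _ Nw.
(* Otherwise switching [N] to [M] on [X] would improve on [N]. *)
have w_le : weight w (edges_at X M) <= weight w (edges_at X N).
  have := weight_exchange X N M w; have := maxN _ (exchange_matching mN mM XN XM).
  lia.
have g_le : weight g (edges_at X M) <= weight g (edges_at X N) by nia.
have uncov y := @exchange_uncovered X M N y XM XN.
exists (exchange X M N); split.
- split; first exact: exchange_matching.
    by move=> e; rewrite inE g_gt0; case: ifP => _; [apply: Nw|apply: Mw].
  move=> A /maxM; have := weight_exchange X M N g; lia.
- by apply: uncov; rewrite xX.
(* [X] cannot contain both [u] and [v], and a vertex outside [X] stays missed. *)
- have [uX|uX] := boolP (u \in X); last by rewrite uncov // (negPf uX).
  have [vX|vX] := boolP (v \in X); last by rewrite [X in _ || X]uncov ?orbT // (negPf vX).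
  by case/eqP: uv; apply: Xfix => //; apply: partner_uncovered.
Qed.

(* Gallai's lemma in weighted form: missing no two common vertices is a
   transitive relation, so it propagates from edges to the component. *)
Lemma max_matching_near_perfect (w g : E -> nat) (k : nat) (C : {set V}) :
  (forall e, (0 < g e) = (0 < w e)) ->
  (forall u v, u \in C -> v \in C -> connect (joined w) u v) ->
  (forall u v, u \in C -> joined w u v -> v \in C) ->
  (forall e, 0 < w e -> (ends e).1 \in C -> (g e + k = k.+1 * w e)%N) ->
  (forall x, x \in C -> exists2 N, max_matching w N & ~~ covers N x) ->
  forall M u v, max_matching g M -> u \in C -> v \in C ->
    ~~ covers M u -> ~~ covers M v -> u = v.
Proof.
move=> g_gt0 Cconn Cclosed gE missed M u v maxM uC vC.
have Cw e y z : 0 < w e -> inc y e -> inc z e -> y \in C -> z \in C.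
  by move=> we ye ze /Cclosed; apply; apply/existsP; exists e; rewrite we ye.
case/connectP: (Cconn _ _ uC vC) => p; elim: p u uC M maxM => [u _ M _ _ -> //|x p IH].
move=> u uC M maxM /= /andP[ux xp] eqv Mu Mv.
have xC := Cclosed _ _ uC ux.
(* If [A] missed two distinct ends of a support edge, adding that edge would increase its weight. *)
have P_ux A : max_matching g A -> ~~ covers A u -> ~~ covers A x -> u = x.
  move=> [mA Ag maxA] Au Ax; apply/eqP; apply: contraT => ux_neq.
  case/existsP: ux => e /and3P[we ue xe].
  have eA : e \notin A by apply: contra Au => eA; apply/exists_inP; exists e.
  have ends_e y : inc y e -> ~~ covers A y.
    move=> ye; case: (incident_cases ue ye) => -> //.
    by case: (incident_cases ue xe) => xu; [rewrite xu eqxx in ux_neq|rewrite -xu].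
  have : matching (e |: A).
    apply/matchingP => e1 e2 y; rewrite !inE.
    move=> /orP[/eqP->|e1A] /orP[/eqP->|e2A] // y1 y2.
    - by case/negP: (ends_e _ y1); apply/exists_inP; exists e2.
    - by case/negP: (ends_e _ y2); apply/exists_inP; exists e1.
    - by move/matchingP: mA => mA; apply: mA y1 y2.
  move/maxA; rewrite /weight big_setU1 //= -[leqRHS]add0n leq_add2r leqn0.
  by move: we; rewrite -g_gt0 lt0n => /negPf ->.
apply/eqP; apply: contraT => uv.
(* If [M'] misses [u], then [u = x] and the rest of the path applies to [M]. If it misses [v], the
   rest of the path applied to [M'] gives [x = v], and [M] misses both ends of the first edge. *)
have [N maxN Nx] := missed x xC.
have [M' [maxM' M'x]] := alternating_exchange g_gt0 Cw gE maxM maxN xC Nx Mu Mv uv.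
case/orP => [M'u|M'v].
  have eux := P_ux _ maxM' M'u M'x.
  by case/eqP: uv; rewrite eux; apply: IH maxM xp eqv _ Mv => //; rewrite -eux.
have exv := IH _ xC _ maxM' xp eqv M'x M'v.
by case/eqP: uv; rewrite -exv; apply: P_ux maxM _ _ => //; rewrite exv.
Qed.

(** If the optimum did not drop, some matching would be optimal for [w] with equal weight under
    [w']; but it covers [u] by a support edge, on which the two weights differ. *)
Lemma star_reduction (w w' : E -> nat) u :
  (forall e, w e = w' e + ((0 < w e) && inc u e))%N ->
  (forall M, max_matching w M -> covers M u) ->
  forall M, matching M -> exists2 N, matching N & weight w' M < weight w N.
Proof.
move=> wE ucov M mM; have [N [mN _ Nmax]] := max_weight_matching w.
exists N => //.
have w'w e : w' e <= w e by rewrite wE leq_addr.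
have w'wM : weight w' M <= weight w M by apply: leq_sum.
rewrite ltn_neqAle (leq_trans w'wM (Nmax _ mM)) andbT; apply/eqP => eqN.
pose M0 := [set e in M | 0 < w e].
have mM0 : matching M0.
  by apply: matching_sub mM; apply/fintype.subsetP => e; rewrite inE => /andP[].
have wM0 : weight w M = weight w M0.
  rewrite /weight (bigID (fun e => 0 < w e)) /= [X in (_ + X)%N]big1 ?addn0.
    by apply: eq_bigl => e; rewrite inE.
  by move=> e /andP[_]; rewrite -leqNgt leqn0 => /eqP.
have eqw : weight w' M = weight w M by apply/eqP; rewrite eqn_leq w'wM eqN Nmax.
have /ucov/exists_inP[e eM ue] : max_matching w M0.
  split=> //; first by move=> e; rewrite inE => /andP[].
  by move=> A /Nmax; rewrite -eqN eqw wM0.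
move: eM; rewrite inE => /andP[eM we].
move/eqP: eqw; rewrite /weight (bigD1 e) //= [X in _ == X](bigD1 e) //=.
apply/negP; rewrite neq_ltn; apply/orP; left; rewrite -addSn leq_add //.
  by rewrite [leqRHS]wE we ue addn1.
by apply: leq_sum.
Qed.

Lemma weightD (w w' : E -> nat) (F0 : {set E}) k :
  (forall e, w e = k * w' e + (e \in F0))%N ->
  forall A, weight w A = (k * weight w' A + #|A :&: F0|)%N.
Proof.
move=> wE A; rewrite /weight -sum1_card big_distrr /=.
rewrite (eq_bigr _ (fun e _ => wE e)) big_split /=; congr addn.
rewrite big_mkcond [RHS]big_mkcond /=; apply: eq_bigr => e _.
by rewrite inE; case: (e \in A); case: (e \in F0).
Qed.

(** A matching missing at most one vertex of [C] has at least [#|C|./2] edges there, and each is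
    worth one more under [w] than under [w']. *)
Lemma component_reduction (w w' : E -> nat) (C : {set V}) :
  (forall u v, u \in C -> v \in C -> connect (joined w) u v) ->
  (forall u v, u \in C -> joined w u v -> v \in C) ->
  (forall x, x \in C -> exists2 N, max_matching w N & ~~ covers N x) ->
  (forall e, w e = w' e + ((0 < w e) && ((ends e).1 \in C)))%N ->
  forall M, matching M ->
    exists2 N, matching N & weight w' M + #|C|./2 <= weight w N.
Proof.
move=> Cconn Cclosed missed w'E M mM.
pose F0 := [set e | (0 < w e) && ((ends e).1 \in C)].
have F0E e : (e \in F0) = (0 < w e) && ((ends e).1 \in C) by rewrite inE.
have wE e : w e = (1 * w' e + (e \in F0))%N by rewrite mul1n F0E.
(* The coefficient makes a [g]-maximal matching [w']-maximal, and among those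
   maximal inside [C]. *)
pose k := #|E|; pose g e := (k.+1 * w' e + (e \in F0))%N.
have gE1 e : g e = (k.+1 * w' e + (e \in F0))%N by [].
have g_gt0 e : (0 < g e) = (0 < w e).
  by rewrite gE1 wE mul1n; case: (w' e) => [|n]; [rewrite muln0|rewrite mulnS !addSn].
(* Here [w' e] is [w e - 1], so [g e] is [(k + 1) (w e - 1) + 1]. *)
have gE e : 0 < w e -> (ends e).1 \in C -> (g e + k = k.+1 * w e)%N.
  move=> we eC; rewrite gE1 [in RHS]w'E F0E we eC.
  by rewrite mulnDr muln1 -addnA add1n.
have [N maxN] := max_weight_matching g; have [mN Ng Nmax] := maxN.
have near := max_matching_near_perfect g_gt0 Cconn Cclosed gE missed maxN.
have Nw e : e \in N -> 0 < w e by move/Ng; rewrite g_gt0.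
have CN : saturated C N.
  move=> e y z /Nw we ye ze /Cclosed; apply.
  by apply/existsP; exists e; rewrite we ye.
have NF : edges_at C N = N :&: F0.
  by apply/setP => e; rewrite !inE; case: (boolP (e \in N)) => //= /Nw ->.
have arith (K a b c d p q : nat) : a <= K -> c <= d + 1 -> a.*2 = d ->
    K.+1 * p + b <= K.+1 * q + a -> p + c./2 <= q + a.
  move=> ak cd ad le_pq; have pq : p <= q.
    rewrite leqNgt; apply/negP => qp.
    have : K.+1 * q.+1 <= K.+1 * p by rewrite leq_mul2l.
    rewrite mulnS; move: (K.+1 * q) (K.+1 * p) le_pq => *; lia.
  clear le_pq; lia.
exists N => //; rewrite (weightD wE) mul1n.
apply: (@arith k #|N :&: F0| #|M :&: F0| _ #|[set v in C | covers N v]|).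
- exact: max_card.
- exact: card_uncovered_le1 near.
- by rewrite -NF; exact: double_card_edges_at.
- by rewrite -!(weightD gE1) Nmax.
Qed.

(** * Integer weights under Edmonds' conditions *)

Section WeightedBound.
Local Open Scope ring_scope.
Variables (F : realFieldType) (f : E -> F).
Hypothesis f_ge0 : forall e, 0 <= f e.
Hypothesis f_star : forall v, \sum_(e | inc v e) f e <= 1.
Hypothesis f_odd : forall U : {set V},
  \sum_(e | ((ends e).1 \in U) && ((ends e).2 \in U)) f e <= (#|U|./2)%:R.

(* The two reductions are the two kinds of dual variables of the matching
   polytope: lowering [w] on a star, or on the edges inside a component. *)
Lemma matching_weight_ge (w : E -> nat) : exists2 M, matching M &
  \sum_e (w e)%:R * f e <= (weight w M)%:R.
Proof.
have [n] := ubnP (\sum_e w e)%N; elim: n w => // n IH w; rewrite ltnS => lt_n.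
have [[t0 [e0 [we0 te0]]] | w0] :=
    pselect (exists t0 e0, (0 < w e0)%N /\ inc t0 e0); last first.
  exists finset.set0; first exact: matching0.
  rewrite big1 // => e _; have [->|we] := posnP (w e); first by rewrite mul0r.
  by case: w0; exists (ends e).1, e; split=> //; exact: incident1.
(* Shared by both reductions: lowering the support edges in [P] by one costs the fractional side at
   most [b] and the matching side at least [b]. The edge [e1] makes the total weight decrease. *)
have reduce (P : pred E) (b : nat) e1 : (0 < w e1)%N -> P e1 ->
    \sum_(e | (0 < w e)%N && P e) f e <= b%:R ->
    (forall w', (forall e, w e = w' e + ((0 < w e) && P e))%N ->
     forall M, matching M -> exists2 N, matching N & (weight w' M + b <= weight w N)%N) ->
  exists2 M, matching M & \sum_e (w e)%:R * f e <= (weight w M)%:R.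
  move=> we1 Pe1 fb step.
  pose w' e := (w e - ((0 < w e) && P e))%N.
  have wE e : w e = (w' e + ((0 < w e) && P e))%N.
    by rewrite /w' subnK //; case: (w e) => //= m; case: (P e).
  have [|M mM Mle] := IH w'.
    apply: leq_trans lt_n; rewrite [leqRHS](eq_bigr _ (fun e _ => wE e)).
    by rewrite big_split /= -addn1 leq_add2l (bigD1 e1) //= we1 Pe1 leq_addr.
  have [N mN Nge] := step w' wE M mM; exists N => //.
  apply: (@le_trans _ _ ((weight w' M)%:R + b%:R)); last by rewrite -natrD ler_nat.
  apply: le_trans (lerD Mle fb).
  rewrite [X in _ + X]big_mkcond -big_split /=; apply: ler_sum => e _.
  rewrite [in leLHS]wE natrD mulrDl lerD2l.
  by case: ifP; rewrite ?mul1r ?mul0r.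
have [[u [[e [we ue]] ucov]]|nocov] := pselect (exists u,
    (exists e, (0 < w e)%N /\ inc u e) /\ forall M, max_matching w M -> covers M u).
  apply: (reduce (inc u) 1%N e) => //.
    apply: le_trans (f_star u); rewrite big_mkcond [leRHS]big_mkcond.
    by apply: ler_sum => e' _; case: (inc u e'); rewrite ?andbF ?andbT //; case: ifP.
  by move=> w' wE M mM; have [N] := star_reduction wE ucov mM; exists N; rewrite ?addn1.
pose C := [set v | connect (joined w) t0 v].
have jsym : symmetric (joined w).
  by move=> u v; apply: eq_existsb => e; rewrite [inc u e && _]andbC.
have Cclosed u v : u \in C -> joined w u v -> v \in C.
  by rewrite !inE => /connect_trans h uv; apply/h/connect1.
have Cconn u v : u \in C -> v \in C -> connect (joined w) u v.
  by rewrite !inE => tu; apply: connect_trans; rewrite (sym_connect_sym jsym).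
have Cinc x : x \in C -> exists e, (0 < w e)%N /\ inc x e.
  rewrite inE => /connectP[p]; case/lastP: p => [_ ->|p y]; first by exists e0.
  rewrite rcons_path last_rcons => /andP[_ /existsP[e /and3P[we _ ye]]] ->.
  by exists e.
have missed x : x \in C -> exists2 N, max_matching w N & ~~ covers N x.
  move=> /Cinc xe; apply: contrapT => nN; apply: nocov; exists x; split=> // M maxM.
  by apply: contraT => Mx; case: nN; exists M.
have Cw e y z : (0 < w e)%N -> inc y e -> inc z e -> y \in C -> z \in C.
  by move=> we ye ze /Cclosed; apply; apply/existsP; exists e; rewrite we ye.
have t0C : t0 \in C by rewrite inE connect0.
apply: (reduce (fun e => (ends e).1 \in C) #|C|./2 e0) => //.
- exact: Cw we0 te0 (incident1 e0) t0C.
- apply: le_trans (f_odd C); rewrite big_mkcond [leRHS]big_mkcond; apply: ler_sum => e _.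
  case: (boolP (0 < w e)%N) => /= [we|_]; last by case: ifP.
  case: (boolP (_ \in C)) => //= eC.
  by rewrite (Cw _ _ _ we (incident1 e) (incident2 e) eC).
- by move=> w' wE; apply: component_reduction.
Qed.

End WeightedBound.

End Matchings.

(** * Edmonds' matching polytope theorem *)

Section MatchingPolytope.
Local Open Scope ring_scope.

Lemma matching_polytope (V E : finType) (ends : E -> V * V) (f : E -> rat) :
  loopless ends -> (forall e, 0 <= f e) ->
  (forall v, \sum_(e | incident ends v e) f e <= 1) ->
  (forall U : {set V},
    \sum_(e | ((ends e).1 \in U) && ((ends e).2 \in U)) f e <= (#|U|./2)%:R) ->
  exists c : {set E} -> rat,
    [/\ forall M, 0 <= c M, \sum_(M <- enum (matching ends)) c M = 1
      & forall e, f e = \sum_(M <- enum (matching ends) | e \in M) c M].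
Proof.
move=> loop f_ge0 f_star f_odd.
(* The extra coordinate, constantly [1], forces the coefficients to sum to one. *)
pose chi (b : E -> rat) (i : E + unit) := if i is inl e then b e else 1.
have dot_chi b x : dot (chi b) x = \sum_e b e * x (inl e) + x (inr tt).
  rewrite /dot big_sumType /=; congr (_ + _).
  by rewrite (big_pred1 tt) ?mul1r // => -[].
have [||c c_ge0 cE] := @farkas rat (E + unit)%type {set E} (enum (matching ends))
    (fun M => chi (fun e => (e \in M)%:R)) (chi f).
- exact: enum_uniq.
- move=> x x_le; rewrite dot_chi.
  have [D D_gt0 zE] := rat_common_denominator (fun e => x (inl e)).
  (* Weights are natural numbers, so negative entries of [x] become zero; as [f] is nonnegative,
     this can only increase the left side. *)
  pose w e := if 0 <= x (inl e) then `|numq (D%:R * x (inl e))|%N else 0%N.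
  have wE e : (w e)%:R = D%:R * Num.max 0 (x (inl e)) :> rat.
    rewrite /w; case: leP => xe; last by rewrite mulr0.
    have [z zxe] := zE e; have z_ge0 : 0 <= z by rewrite -(ler0z rat) -zxe mulr_ge0.
    by rewrite zxe numq_int natr_absz ger0_norm.
  have [M mM] := matching_weight_ge loop f_ge0 f_star f_odd w.
  rewrite /weight natr_sum (eq_bigr _ (fun e _ => wE e)) -mulr_sumr.
  under eq_bigr => e _ do rewrite wE -mulrA.
  rewrite -mulr_sumr ler_pM2l ?ltr0n // => le_M.
  (* Dropping the edges with negative entries makes the true weight of the matching equal to its
     truncated weight. *)
  pose M0 := [set e in M | 0 <= x (inl e)].
  have mM0 : matching ends M0.
    by apply: matching_sub mM; apply/fintype.subsetP => e; rewrite inE => /andP[].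
  have := x_le M0; rewrite mem_enum => /(_ mM0); rewrite dot_chi.
  apply: le_trans; rewrite lerD2r.
  apply: (@le_trans _ _ (\sum_e Num.max 0 (x (inl e)) * f e)).
    by apply: ler_sum => e _; rewrite mulrC ler_wpM2r // le_max lexx orbT.
  apply: le_trans le_M _; rewrite big_mkcond; apply: ler_sum => e _.
  rewrite inE; case: (e \in M) => /=; last by rewrite mul0r.
  by case: (leP 0 (x (inl e))); rewrite ?mul1r ?mul0r.
exists c; split=> //.
  by have /= -> := cE (inr tt); apply: eq_bigr => M _; rewrite mulr1.
move=> e; have /= -> := cE (inl e); rewrite [RHS]big_mkcond; apply: eq_bigr => M _.
by case: (e \in M); rewrite ?mulr1 ?mulr0.
Qed.

End MatchingPolytope.

(** * From convex combinations to measurable colorings *)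

Section IntervalColoring.
Local Open Scope classical_set_scope.
Local Open Scope ring_scope.

(** Intervals of lengths [c M] are laid end to end, and each edge receives those of the matchings
    containing it. Half-open intervals keep consecutive pieces disjoint, and the free start [a]
    serves the induction. *)
Lemma interval_coloring (R : realType) (E : finType) (s : seq {set E})
    (c : {set E} -> R) (a : R) :
  (forall M, 0 <= c M) ->
  exists phi : E -> set R,
    (forall e, [/\ phi e `<=` `[a, a + \sum_(M <- s) c M[, measurable (phi e)
      & lebesgue_measure (phi e) = (\sum_(M <- s | e \in M) c M)%:E]) /\
    (forall e e', (forall M, M \in s -> e \in M -> e' \notin M) ->
       phi e `&` phi e' = set0).
Proof.
move=> c_ge0; elim: s a => [|M s IH] a.
  exists (fun=> set0); split=> [e|e e' _]; last by rewrite setI0.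
  by split=> //; rewrite big_nil measure0.
have [phi [phiP disj]] := IH (a + c M).
pose psi e : set R := if e \in M then `[a, a + c M[%classic else set0.
have sum_ge0 : 0 <= \sum_(M <- s) c M by apply: sumr_ge0.
have psi_phi e e' : psi e `&` phi e' = set0.
  rewrite /psi; case: ifP => _; last by rewrite set0I.
  rewrite -subset0 => y [] /=; rewrite in_itv /= => /andP[_ y1].
  have [sub _ _] := phiP e' => /sub /=; rewrite in_itv /= => /andP[y2 _].
  by move: (lt_le_trans y1 y2); rewrite ltxx.
have mpsi e : measurable (psi e) by rewrite /psi; case: ifP.
exists (fun e => psi e `|` phi e); split=> [e|e e' notin].
  have [sub mphi muphi] := phiP e; rewrite big_cons; split.
  - rewrite subUset; split.
      rewrite /psi; case: ifP => _ // y /=; rewrite !in_itv /= => /andP[-> y1] /=.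
      by apply: lt_le_trans y1 _; rewrite lerD2l lerDl.
    move=> y /sub /=; rewrite !in_itv /= addrA => /andP[y1 ->]; rewrite andbT.
    by apply: le_trans y1; rewrite lerDl.
  - exact: measurableU.
  - rewrite measureU //=; last exact: mpsi.
    rewrite muphi big_cons /psi; case: ifP => _; last by rewrite measure0 add0e.
    rewrite lebesgue_measure_itv /= lte_fin ltrDl.
    case: ltP => cM; first by rewrite -EFinB addrAC subrr add0r EFinD.
    have -> : c M = 0 by apply/le_anti; rewrite cM c_ge0.
    by rewrite add0e add0r.
rewrite /= setIUl !setIUr [phi e `&` psi e']setIC !psi_phi setU0 set0U.
rewrite disj ?setU0; last by move=> N Ns; apply: notin; rewrite inE Ns orbT.
have := notin M; rewrite inE eqxx => /(_ isT); rewrite /psi.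
by case: ifP => [_ /(_ isT) /negPf ->|_ _]; rewrite ?setI0 ?set0I.
Qed.

End IntervalColoring.

(** * The local demand bound implies Edmonds' conditions *)

Section LocalDemand.
Local Open Scope ring_scope.
Variables (V E : finType) (ends : E -> V * V) (F : realFieldType) (f : E -> F).
Hypothesis ends_loopless : loopless ends.
Hypothesis f_le : forall e,
  f e <= ((maxn (deg ends (ends e).1) (deg ends (ends e).2)
           + mult ends (ends e).1 (ends e).2)%:R)^-1.

Local Notation inc := (incident ends).
Local Notation d v := #|[set e | inc v e]|.
Local Notation mu v u := #|[set e | inc v e & other_end ends v e == u]|.

(** [deg] and [mult] count classical sets; this lemma and the next pass to finite sets. *)
Lemma degE v : deg ends v = d v.
Proof. by apply: eq_card => e; rewrite !inE; apply/idP/idP; rewrite in_setE. Qed.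

Lemma multE u v : mult ends u v = #|[set e | inc u e & inc v e]|.
Proof. by apply: eq_card => e; rewrite !inE; apply/idP/idP; rewrite in_setE. Qed.

(** Weakens the hypothesis to the degree of [v] alone, so that the edges at [v] can be summed. *)
Lemma demand_le v e : inc v e -> f e <= ((d v + mu v (other_end ends v e))%:R)^-1.
Proof.
move=> ve; set u := other_end ends v e.
have d_gt0 : (0 < d v)%N by apply/card_gt0P; exists e; rewrite inE.
have d_le : (d v <= maxn (deg ends (ends e).1) (deg ends (ends e).2))%N.
  by rewrite !degE leq_max; case/orP: ve => /eqP <-; rewrite leqnn ?orbT.
apply: le_trans (f_le e) _.
rewrite lef_pV2 ?posrE ?ltr0n ?addn_gt0 ?d_gt0 ?(leq_trans d_gt0 d_le) //.
rewrite ler_nat leq_add //.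
rewrite multE subset_leq_card //; apply/fintype.subsetP => e'.
rewrite !inE -!/(inc _ _) => /andP[ve' /eqP ue'].
have ue2 : inc u e' by rewrite -ue' incident_other.
have both y : inc y e -> inc y e' by move=> ye; case: (incident_cases ve ye) => ->.
by rewrite !both ?incident1 ?incident2.
Qed.

Lemma demand_star v : \sum_(e | inc v e) f e <= 1.
Proof.
have [d0|d_gt0] := posnP (d v).
  rewrite big_pred0 ?ler01 // => e; apply/negP => ve.
  by have := card0_eq d0 e; rewrite inE ve.
apply: (@le_trans _ _ (\sum_(e in [set e | inc v e]) (d v)%:R^-1)).
  rewrite [leRHS](eq_bigl (inc v)) => [|e]; last by rewrite inE.
  apply: ler_sum => e /demand_le /le_trans; apply.
  by rewrite lef_pV2 ?posrE ?ltr0n ?addn_gt0 ?d_gt0 // ler_nat leq_addr.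
by rewrite sumr_const -[leLHS]mulr_natr mulVf // pnatr_eq0 -lt0n.
Qed.

(* The tangent at [mu = d / k] of the concave function [mu |-> mu / (d + mu)]. *)
Lemma ratio_le_tangent (d m k : nat) : (0 < d)%N ->
  m%:R / (d + m)%:R <= (1 + k%:R ^+ 2 * (m%:R / d%:R)) / k.+1%:R ^+ 2 :> F.
Proof.
move=> d_gt0; rewrite ler_pdivlMr ?exprn_gt0 ?ltr0n // mulrAC.
rewrite ler_pdivrMr ?ltr0n ?addn_gt0 ?d_gt0 // natrD -natr1.
have dF : 0 < d%:R :> F by rewrite ltr0n.
rewrite -(ler_pM2r dF).
have -> : (1 + k%:R ^+ 2 * (m%:R / d%:R)) * (d%:R + m%:R) * d%:R
   = (d%:R + k%:R ^+ 2 * m%:R) * (d%:R + m%:R) :> F.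
  by field; rewrite gt_eqF.
have := sqr_ge0 (d%:R - k%:R * m%:R : F); nra.
Qed.

(** Edges are grouped by their other end. Summed over the [k] vertices of [U :\ v], the tangent
    bound gives at most [(k + k^2) / (k + 1)^2], since the multiplicities add up to at most
    [d v]. *)
Lemma demand_star_inside (U : {set V}) (k : nat) v : v \in U -> #|U| = k.+1 ->
  \sum_(e | ((ends e).1 \in U) && ((ends e).2 \in U) && inc v e) f e <= k%:R / k.+1%:R.
Proof.
move=> vU cU.
have cUv : #|U :\ v| = k by apply/eqP; rewrite -eqSS -cU (cardsD1 v U) vU.
rewrite (partition_big (other_end ends v) [in U :\ v]) /=; last first.
  move=> e /andP[/andP[e1 e2] ve]; rewrite !inE other_end_neq //=.
  by rewrite /other_end; case: ifP.
have [d0|d_gt0] := posnP (d v).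
  rewrite big1 ?divr_ge0 // => u _; rewrite big_pred0 // => e; apply/negP.
  by move=> /andP[/andP[_ ve] _]; have := card0_eq d0 e; rewrite inE ve.
apply: (@le_trans _ _ (\sum_(u in U :\ v)
    (1 + k%:R ^+ 2 * ((mu v u)%:R / (d v)%:R)) / k.+1%:R ^+ 2)).
  apply: ler_sum => u _; apply: le_trans (ratio_le_tangent _ _ d_gt0).
  rewrite mulrC mulr_natr -sumr_const big_mkcond [leRHS]big_mkcond.
  apply: ler_sum => e _; rewrite inE.
  case: (boolP (inc v e)) => ve; rewrite ?andbF //= andbT.
  case: eqP => [<-|_]; rewrite ?andbF // andbT; case: ifP => _; first exact: demand_le.
  by rewrite invr_ge0.
have mu_d : (\sum_(u in U :\ v) mu v u <= d v)%N.
  rewrite -sum1_card (partition_big (other_end ends v) predT) //=.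
  rewrite [leqRHS](bigID [in U :\ v]) /=; apply: leq_trans (leq_addr _ _).
  apply: leq_sum => u _; rewrite -sum1_card; apply: eq_leq; apply: eq_bigl => e.
  by rewrite !inE.
rewrite -mulr_suml big_split /= sumr_const cUv -mulr_sumr -mulr_suml -natr_sum.
set S := (\sum_(u in _) _)%N in mu_d *.
rewrite ler_pdivrMr ?exprn_gt0 ?ltr0n //.
have -> : k%:R / k.+1%:R * k.+1%:R ^+ 2 = k%:R + k%:R ^+ 2 :> F.
  by rewrite -natr1; field; rewrite natr1 pnatr_eq0.
rewrite lerD2l -[leRHS]mulr1 ler_wpM2l ?exprn_ge0 //.
by rewrite ler_pdivrMr ?ltr0n // mul1r ler_nat.
Qed.

(** Summing the previous bound over [U] counts each edge twice, so twice the sum is at most [k],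
    which is at most twice [(k + 1)./2]. *)
Lemma demand_odd (U : {set V}) :
  \sum_(e | ((ends e).1 \in U) && ((ends e).2 \in U)) f e <= (#|U|./2)%:R.
Proof.
case cU : #|U| => [|k].
  rewrite big_pred0 // => e; apply/negP => /andP[eU _].
  by move: (card0_eq cU (ends e).1); rewrite eU.
rewrite -(ler_pM2l (ltr0Sn F 1)).
apply: (@le_trans _ _ k%:R); last first.
  by rewrite -natrM ler_nat; lia.
have -> : 2 * \sum_(e | ((ends e).1 \in U) && ((ends e).2 \in U)) f e
  = \sum_(v in U) \sum_(e | ((ends e).1 \in U) && ((ends e).2 \in U) && inc v e) f e.
  rewrite mulr_sumr.
  rewrite (exchange_big_dep (fun e => ((ends e).1 \in U) && ((ends e).2 \in U))) /=.
    apply: eq_bigr => e /andP[e1 e2].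
    rewrite (eq_bigl [in [set (ends e).1; (ends e).2]]) => [|v].
      by rewrite sumr_const cards2 ends_loopless mulr_natl.
    rewrite !inE e1 e2 /= -/(inc v e); apply/andP/idP => [[]//|ve]; split=> //.
    by case/orP: ve => /eqP ->.
  by move=> v e _ /andP[].
apply: (@le_trans _ _ (\sum_(v in U) k%:R / k.+1%:R)).
  by apply: ler_sum => v vU; apply: demand_star_inside.
by rewrite sumr_const cU -[leLHS]mulr_natr divfK // pnatr_eq0.
Qed.

End LocalDemand.

Theorem theorem1p8 (R : realType) (V E : finType) (ends : E -> V * V)
  (f : E -> rat) :
  loopless ends ->
  demand f ->
  (forall e : E,
     (f e <= ((maxn (deg ends (ends e).1) (deg ends (ends e).2)
               + mult ends (ends e).1 (ends e).2)%:R)^-1)%R) ->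
  exists phi : E -> set R, f_coloring ends f phi.
Proof.
move=> loop f01 f_le; have f_ge0 e : (0 <= f e)%R by case/andP: (f01 e).
have [c [c_ge0 c1 cE]] :=
  matching_polytope loop f_ge0 (demand_star f_le) (demand_odd loop f_le).
have c_ge0R M : (0 <= ratr (c M) :> R)%R by rewrite ler0q.
have [phi [phiP disj]] := interval_coloring (enum (matching ends)) 0%R c_ge0R.
have cR1 : (\sum_(M <- enum (matching ends)) ratr (c M) = 1 :> R)%R.
  by rewrite -rmorph_sum c1 rmorph1.
exists phi; split; [|split].
- move=> e; have [sub mphi _] := phiP e; split=> // y /sub /=.
  by rewrite cR1 add0r !in_itv /= => /andP[-> /ltW].
- move=> e e' ee'; apply: disj => M; rewrite mem_enum => /forall_inP mM eM.
  by apply: contraL ee' => e'M; move/forall_inP: (mM e eM); apply.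
- move=> e; have [_ _ ->] := phiP e.
  by rewrite lee_fin cE rmorph_sum.
Qed.
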